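(* Let $\mathsf F,\mathsf P,\mathsf C$ be separable Hilbert spaces, $\mathcal P\in L(\mathsf F,\mathsf P)$, $\mathcal C\in L(\mathsf P,\mathsf C)$, and let $\{X(t)\}_{t\ge 0}$ be an $\mathsf F$-valued predictable process. Let $(\mathcal C,\mathcal P)$ be a cointegration pricing system for the factor process $X$. Assume that $\dim\big((\ker\mathcal C)^{\perp}\big)=:d<\infty$ and $\dim\big((\ker\mathcal P)^{\perp}\big)=:n<\infty$ for $n,d\in\mathbb N$. Then for every $\mathcal T\in\mathsf C^*$ there exist $\mathbf c_{\mathcal T}\in\mathbb R^d$, $\overline{\mathcal P}\in\mathbb R^{d\times n}$ and an $\mathbb R^n$-valued factor process $\mathbf X(t)$ such that $$\mathcal T\mathcal C\mathcal PX(t)=\mathbf c_{\mathcal T}^{\top}\overline{\mathcal P}\mathbf X(t),$$ and the real-valued process $t\mapsto\mathbf c_{\mathcal T}^{\top}\overline{\mathcal P}\mathbf X(t)$ admits a limiting distribution.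
   Context: $L(\cdot,\cdot)$ denotes bounded linear operators, $\mathsf C^*$ the topological dual of $\mathsf C$ (continuous linear functionals $\mathsf C\to\mathbb R$), and $\perp$ the orthogonal complement. $(\mathcal C,\mathcal P)$ is a cointegration pricing system if the $\mathsf C$-valued process $\{\mathcal C\mathcal PX(t)\}_{t\ge 0}$ admits a limiting distribution, i.e. there is a probability measure $P_\infty$ on the Borel sets of $\mathsf C$ such that the law of $\mathcal C\mathcal PX(t)$ converges weakly to $P_\infty$ as $t\to\infty$ (tested against bounded continuous functions). Likewise for real-valued processes. *)

(* Defs.v *)
From HB Require Import structures.
From mathcomp Require Import all_boot all_order all_algebra.
From mathcomp Require Import all_classical all_reals all_analysis.

Set Implicit Arguments.
Unset Strict Implicit.
Unset Printing Implicit Defensive.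

Import Order.TTheory GRing.Theory Num.Theory.
Import numFieldNormedType.Exports.

Local Open Scope classical_set_scope.
Local Open Scope ring_scope.

(* Real Hilbert spaces: complete normed spaces whose norm comes from an inner
   product. *)
HB.mixin Record CompleteNormedModule_isHilbert (R : realType) V
    of CompleteNormedModule R V := {
  inner : {dot V for idfun} ;
  inner_norm : forall x : V, inner x x = `|x| ^+ 2
}.

#[short(type="hilbertType")]
HB.structure Definition Hilbert (R : realType) :=
  {V of CompleteNormedModule R V & CompleteNormedModule_isHilbert R V}.

Definition separable (T : topologicalType) : Prop :=
  exists2 D : set T, countable D & dense D.

Definition bounded_operator (R : realType) (V W : normedModType R)
    (A : {linear V -> W}) : Prop :=
  exists M : R, forall x, `|A x| <= M * `|x|.

Definition ker (R : realType) (V W : normedModType R) (A : {linear V -> W}) :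
  set V := A @^-1` [set 0].

Definition ortho_compl (R : realType) (V : hilbertType R) (S : set V) : set V :=
  [set x | forall y, S y -> inner x y = 0].

Definition has_dim (R : realType) (V : lmodType R) (S : set V) (n : nat) : Prop :=
  exists e : 'I_n -> V,
    (forall a : 'I_n -> R, \sum_(i < n) a i *: e i = 0 -> forall i, a i = 0) /\
    S = [set x | exists a : 'I_n -> R, x = \sum_(i < n) a i *: e i].

Notation borel E := (g_sigma_algebraType (@open E)).

(* Processes are indexed by all of R, but only their values at times t >= 0 are
   ever constrained. *)
Section processes.
Context {R : realType} {d : measure_display} {Omega : measurableType d}.

Definition filtration (Fl : R -> set (set Omega)) : Prop :=
  [/\ forall t, 0 <= t -> sigma_algebra [set: Omega] (Fl t),
      forall t, 0 <= t -> Fl t `<=` measurable &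
      forall s t, 0 <= s -> s <= t -> Fl s `<=` Fl t].

Definition predictable_rectangles (Fl : R -> set (set Omega)) :
    set (set (R * Omega)) :=
  [set B | (exists2 A, Fl 0 A & B = [set 0] `*` A) \/
           (exists s t A, [/\ 0 <= s, s < t, Fl s A & B = `]s, t] `*` A])].

(* [0, +oo[ x Omega belongs to the sigma-algebra generated on R x Omega by the
   rectangles, whose trace on it is therefore the predictable sigma-algebra. *)
Definition predictable (E : ptopologicalType) (Fl : R -> set (set Omega))
    (Y : R -> Omega -> E) : Prop :=
  @measurable_fun _ _ (g_sigma_algebraType (predictable_rectangles Fl)) (borel E)
    ([set t : R | 0 <= t] `*` [set: Omega]) (fun z => Y z.1 z.2).

Definition admits_limiting_distribution (E : ptopologicalType)
    (P : probability Omega R) (Y : R -> Omega -> E) : Prop :=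
  (forall t, 0 <= t -> measurable_fun [set: Omega] (Y t : Omega -> borel E)) /\
  exists Pinf : probability (borel E) R,
    forall f : E -> R, continuous f -> [bounded f x | x in [set: E]] ->
      (fun t => \int[pushforward P (Y t : Omega -> borel E)]_x (f x)%:E)%E
        @ +oo --> (\int[Pinf]_x (f x)%:E)%E.

Definition cointegration_pricing_system (VF VP VC : hilbertType R)
    (P : probability Omega R) (opC : {linear VP -> VC}) (opP : {linear VF -> VP})
    (X : R -> Omega -> VF) : Prop :=
  admits_limiting_distribution P (fun t w => opC (opP (X t w))).

End processes.

(* Main.v *)
Require Import Defs.
From HB Require Import structures.
From mathcomp Require Import all_boot all_order all_algebra.
From mathcomp Require Import all_classical all_reals all_analysis.
From mathcomp Require Import measurable_realfun ring lra.

(** By the Riesz representation theorem, a continuous functional that vanishes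
    on the kernel of a bounded operator A is the inner product with a vector
    orthogonal to that kernel.  When the orthogonal complement of the kernel is
    spanned by e_1, ..., e_n, the functional at x is thus a linear combination
    of the n coordinates <x, e_i>: this is [functional_coordinates].

    It is used twice.  With A = opC and a basis f_1, ..., f_d of the orthogonal
    complement of ker opC, the functional opT o opC at y is a combination of
    the <y, f_j>, whose coefficients form the vector cT.  With A = opP, each
    functional x |-> <opP x, f_j> is a combination of the <x, e_i>, whose
    coefficients form row j of Pbar.  The factor process Xbar consists of the
    coordinates <X(t), e_i>; neither it nor Pbar depends on opT.  Xbar is
    predictable as a continuous image of X, and the real-valued process has a
    limiting distribution because it is the image of opC (opP X) under the
    continuous map opT, and continuous images preserve weak convergence.

    The Riesz theorem itself is proved variationally: the representing vector
    of phi is the minimizer of the energy |x|^2 / 2 - phi x, whose minimizing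
    sequences are Cauchy by the parallelogram law. *)

Set Implicit Arguments.
Unset Strict Implicit.
Unset Printing Implicit Defensive.

Import Order.TTheory GRing.Theory Num.Theory.
Import numFieldNormedType.Exports.

Local Open Scope classical_set_scope.
Local Open Scope ring_scope.

(** * Riesz representation *)

Section riesz.
Context {R : realType} {V : hilbertType R}.
Implicit Types x y u : V.

Lemma innerC x y : inner x y = inner y x.
Proof. by rewrite hermC expr0 mul1r. Qed.

Lemma inner_lincomb a x y u :
  inner (a *: x + y) u = a * inner x u + inner y u.
Proof. exact: linearPl. Qed.

Lemma innerDl x y u : inner (x + y) u = inner x u + inner y u.
Proof. exact: linearDl. Qed.

Lemma innerZr a x y : inner x (a *: y) = a * inner x y.
Proof.
by rewrite innerC -[a *: y]addr0 inner_lincomb linear0l addr0 innerC.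
Qed.

Lemma innerNr x y : inner x (- y) = - inner x y.
Proof. exact: linearNr. Qed.

Lemma sqr_normD x y : `|x + y| ^+ 2 = `|x| ^+ 2 + inner x y *+ 2 + `|y| ^+ 2.
Proof.
rewrite -!inner_norm !innerDl !(innerC _ (x + y)) !innerDl (innerC y x).
by rewrite addrA -(addrA (inner x x)).
Qed.

(** Gives the continuity of the inner product from that of the norm, without
    the Cauchy-Schwarz inequality. *)
Lemma inner_polarization x y :
  inner x y = (`|x + y| ^+ 2 - `|x| ^+ 2 - `|y| ^+ 2) / 2.
Proof. by rewrite sqr_normD mulr2n; field. Qed.

Lemma inner_continuousl u : continuous (inner^~ u).
Proof.
have -> : inner^~ u = fun x => (`|x + u| ^+ 2 - `|x| ^+ 2 - `|u| ^+ 2) / 2.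
  by apply/funext => x; exact: inner_polarization.
move=> x; apply: cvgMl; apply: cvgB; last exact: cvg_cst.
have sqr_norm_cvg (f : V -> V) : f y @[y --> x] --> f x ->
    `|f y| ^+ 2 @[y --> x] --> `|f x| ^+ 2.
  by move=> fx; rewrite expr2; under eq_fun do rewrite expr2; apply: cvgM;
    exact: cvg_norm.
apply: cvgB; last exact: (sqr_norm_cvg id).
by apply: (sqr_norm_cvg (fun y => y + u)); apply: cvgD => //; exact: cvg_cst.
Qed.

Context (phi : {linear V -> R^o}) (phi_cont : continuous phi).

(** The convex functional whose critical points are the vectors representing
    [phi]: its derivative at u in the direction v is <u, v> - phi v. *)
Definition energy x : R := `|x| ^+ 2 / 2 - phi x.

(** The parallelogram law; the linear part of the energy cancels.  Since the
    energy of the midpoint is at least the infimum, two points of nearly minimal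
    energy are close to each other. *)
Lemma energy_midpoint x y :
  `|x - y| ^+ 2 = 4 * (energy x + energy y - 2 * energy (2^-1 *: (x + y))).
Proof.
have E : `|2^-1 *: (x + y)| ^+ 2 = `|x + y| ^+ 2 / 4.
  by rewrite normrZ gtr0_norm ?invr_gt0// exprMn; field.
have P : phi (2^-1 *: (x + y)) = (phi x + phi y) / 2.
  by rewrite linearZ/= linearD mulrC.
by rewrite /energy E P !sqr_normD normrN innerNr !mulr2n; field.
Qed.

Lemma energy_line u v t :
  energy (u + t *: v) =
  energy u + t * (inner u v - phi v) + t ^+ 2 * `|v| ^+ 2 / 2.
Proof.
rewrite /energy sqr_normD innerZr normrZ exprMn real_normK ?num_real//.
have -> : phi (u + t *: v) = phi u + t * phi v by rewrite linearD linearZ.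
by rewrite mulr2n; field.
Qed.

(** If |phi x| <= M |x|, completing the square in |x| bounds the energy below
    by - M^2 / 2. *)
Lemma energy_lbounded : exists m, forall x, m <= energy x.
Proof.
have /linear_bounded_continuous/linear_boundedP := phi_cont.
move=> /pinfty_ex_gt0 [M M0 phiM]; exists (- (M ^+ 2 / 2)) => x.
have := phiM x; have := ler_norm (phi x); rewrite /energy => h1 h2.
have := sqr_ge0 (`|x| - M); nra.
Qed.

Lemma energy_continuous : continuous energy.
Proof.
move=> x; apply: cvgB; last exact: phi_cont.
by apply: cvgMl; rewrite expr2; under eq_fun do rewrite expr2; apply: cvgM;
  exact: cvg_norm.
Qed.

(** A sequence along which the energy tends to its infimum is Cauchy by
    [energy_midpoint]; completeness and continuity of the energy make its limit
    a minimizer. *)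
Lemma energy_min : exists u, forall x, energy u <= energy x.
Proof.
have [m0 m0P] := energy_lbounded.
have Einf : has_inf (range energy).
  split; first by exists (energy 0), 0.
  by exists m0 => _ [x _ <-].
pose m := inf (range energy).
have mP x : m <= energy x by apply: ge_inf; [exact: Einf.2|exists x].
have /choice [x xP] : forall k, exists x, energy x < m + harmonic k.
  move=> k; have [] := @inf_adherent _ (range energy) (harmonic k) _ Einf.
    by rewrite invr_gt0.
  by move=> _ [x _ <-] ?; exists x.
have xcvg : cvg (x @ \oo).
  apply/cauchy_cvgP/cauchy_ballP => e e0; near_simpl.
  (* energies within e ^+ 2 / 8 of the infimum put the points within
     4 * (e ^+ 2 / 8 + e ^+ 2 / 8) = e ^+ 2 in squared distance *)
  have small : \forall k \near \oo, harmonic k < e ^+ 2 / 8 :> R.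
    apply: (cvgr_lt 0); first exact: cvg_harmonic.
    by rewrite divr_gt0// exprn_gt0.
  near=> i j; rewrite -ball_normE /ball_/=.
  rewrite -(@ltr_pXn2r _ 2)// ?nnegrE ?(ltW e0)// energy_midpoint.
  have si : harmonic i < e ^+ 2 / 8 :> R by near: i.
  have sj : harmonic j < e ^+ 2 / 8 :> R by near: j.
  have := mP (2^-1 *: (x i + x j)); have := xP i; have := xP j; lra.
exists (lim (x @ \oo)) => y; apply: le_trans (mP y).
have Ex : energy (x k) @[k --> \oo] --> energy (lim (x @ \oo)).
  by apply: continuous_cvg => //; exact: energy_continuous.
have mh : m + harmonic k @[k --> \oo] --> m.
  rewrite -[X in _ --> X]addr0; apply: cvgD; first exact: cvg_cst.
  exact: cvg_harmonic.
by apply: ler_cvg_to Ex mh _; near=> k; exact/ltW.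
Unshelve. all: by end_near. Qed.

(** At a minimizer u of the energy, t |-> energy (u + t v) is a quadratic
    polynomial in t minimal at t = 0, so its linear coefficient <u, v> - phi v
    vanishes. *)
Lemma riesz_representation : exists u, forall x, phi x = inner x u.
Proof.
have [u umin] := energy_min; exists u => v.
set a := inner u v - phi v; set b := `|v| ^+ 2.
have b0 : 0 <= b by rewrite exprn_ge0.
have b1 : 0 < b + 1 by lra.
suff a0 : a = 0 by rewrite innerC; apply/esym/eqP; rewrite -subr_eq0 -/a a0.
(* the minimizer of the quadratic is t = - a / b; taking b + 1 keeps the
   denominator nonzero and still makes the energy decrease unless a = 0 *)
have := umin (u + (- (a / (b + 1))) *: v); rewrite energy_line -/a -/b => h.
have E : - (a / (b + 1)) * a + (- (a / (b + 1))) ^+ 2 * b / 2 =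
  - ((a / (b + 1)) ^+ 2 * (b / 2 + 1)).
  by field; rewrite gt_eqF.
have h2 : (a / (b + 1)) ^+ 2 * (b / 2 + 1) <= 0.
  by move: h; rewrite -addrA lerDl E oppr_ge0.
have : (a / (b + 1)) ^+ 2 <= 0.
  by move: h2; rewrite pmulr_lle0//; lra.
by rewrite exprn_even_le0//= mulf_eq0 invr_eq0 (gt_eqF b1) orbF => /eqP.
Qed.

End riesz.

(** * Functionals vanishing on a kernel of finite codimension *)

Lemma bounded_operator_continuous (R : realType) (V W : normedModType R)
  (A : {linear V -> W}) : bounded_operator A -> continuous A.
Proof.
move=> [M AM]; apply/linear_bounded_continuous/linear_boundedP.
exists M; split=> [|r Mr x]; first exact: num_real.
by apply: le_trans (AM x) _; rewrite ler_wpM2r// ltW.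
Qed.

(** The vector representing [phi] is orthogonal to [S], hence a combination of
    the [e i], whose coefficients are the [b i]. *)
Lemma functional_coordinates (R : realType) (V : hilbertType R) (S : set V)
    (n : nat) (e : 'I_n -> V) (phi : {linear V -> R^o}) :
  ortho_compl S = [set x | exists a : 'I_n -> R, x = \sum_(i < n) a i *: e i] ->
  continuous phi -> (forall x, S x -> phi x = 0) ->
  exists b : 'I_n -> R, forall x, phi x = \sum_(i < n) b i * inner x (e i).
Proof.
move=> Se phi_cont phi0; have [u phiE] := riesz_representation phi_cont.
have : ortho_compl S u by move=> y Sy; rewrite innerC -phiE phi0.
rewrite Se => -[b uE]; exists b => x; rewrite phiE uE linear_sumr.
by apply: eq_bigr => i _; exact: innerZr.
Qed.

(** * Continuous images of random variables *)

Section borel_measurability.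
Context {E E' : ptopologicalType}.

Lemma continuous_borel (g : E -> E') : continuous g ->
  measurable_fun [set: borel E] (g : borel E -> borel E').
Proof.
move=> /continuousP cg; apply: (measurability (@open E' : set (set (borel E'))) erefl).
by move=> _ [B oB <-]; rewrite setTI; apply: sub_sigma_algebra; exact: cg.
Qed.

(** Here R carries its usual sigma-algebra, generated by half-open intervals and
    used by the integral, which is not by definition [borel R]. *)
Lemma continuous_borel_real (R : realType) (f : E -> R) : continuous f ->
  measurable_fun [set: borel E] (f : borel E -> R).
Proof.
move=> /continuousP cf; apply: (measurability _ (RGenOpens.measurableE R)).
move=> _ [_ [a [b ->]] <-]; rewrite setTI; apply: sub_sigma_algebra.
exact/cf/interval_open.
Qed.

End borel_measurability.

Lemma integral_pushforward_bounded (R : realType) (d : measure_display)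
    (T : measurableType d) (P : probability T R) (E : ptopologicalType)
    (Y : T -> borel E) (f : E -> R) :
  measurable_fun [set: T] Y -> continuous f -> [bounded f x | x in [set: E]] ->
  (\int[pushforward P Y]_x (f x)%:E = \int[P]_w (f (Y w))%:E)%E.
Proof.
move=> mY cf [M [Mreal fM]].
have mf := continuous_borel_real cf.
rewrite (@integral_pushforward _ _ _ _ _ _ mY P setT (EFin \o f))//.
- exact/measurable_EFinP.
- rewrite preimage_setT; apply: (measurable_bounded_integrable (f := f \o Y)) => //.
  + by apply: (le_lt_trans (probability_le1 P measurableT)); rewrite ltry.
  + exact: measurableT_comp mf mY.
  + by exists M; split => // r Mr w _; exact: fM.
Qed.

(** Continuous mapping theorem: a bounded continuous test function f on E' gives
    the bounded continuous test function f o g on E, so the image under g of the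
    limit law is the limit law of the image process. *)
Lemma admits_limiting_distribution_comp (R : realType) (d : measure_display)
    (Omega : measurableType d) (P : probability Omega R)
    (E E' : ptopologicalType) (g : E -> E') (Y : R -> Omega -> E) :
  continuous g -> admits_limiting_distribution P Y ->
  admits_limiting_distribution P (fun t w => g (Y t w)).
Proof.
move=> cg [mY [Q YQ]].
have mg := continuous_borel cg.
have mgY t : 0 <= t -> measurable_fun setT (fun w => g (Y t w) : borel E').
  by move=> t0; exact: measurableT_comp mg (mY _ t0).
pose gm : {mfun borel E >-> borel E'} :=
  HB.pack (g : borel E -> borel E')
    (isMeasurableFun.Build _ _ (borel E) (borel E') g mg).
split; first exact: mgY.
exists (distribution Q gm) => f cf bf.
have cfg : continuous (f \o g).
  by move=> x; apply: continuous_comp; [exact: cg|exact: cf].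
have bfg : [bounded (f \o g) x | x in [set: E]].
  by case: bf => M [Mreal fM]; exists M; split => // r Mr x _; exact: fM.
rewrite (integral_pushforward_bounded Q mg cf bf).
(* Y t is measurable only for t >= 0, so the change of variables holds only
   eventually *)
have := YQ _ cfg bfg; apply: cvg_trans.
apply: near_eq_cvg; near=> t.
have t0 : 0 <= t by near: t; apply: nbhs_pinfty_ge; rewrite num_real.
by rewrite !integral_pushforward_bounded//; [exact: mgY|exact: mY].
Unshelve. all: by end_near. Qed.

Lemma predictable_comp (R : realType) (d : measure_display)
    (Omega : measurableType d) (Fl : R -> set (set Omega))
    (E E' : ptopologicalType) (g : E -> E') (Y : R -> Omega -> E) :
  continuous g -> predictable Fl Y -> predictable Fl (fun t w => g (Y t w)).
Proof.
move=> cg; rewrite /predictable; apply: measurableT_comp.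
exact: continuous_borel.
Qed.

Lemma matrix_continuous (R : realType) (T : topologicalType) (m n : nat)
    (g : T -> 'M[R]_(m, n)) :
  (forall i j, continuous (fun x => g x i j)) -> continuous g.
Proof.
move=> cg x; apply/cvg_ballP => e e0; near=> y; split=> //.
near: y; apply: filter_forall => i; apply: filter_forall => j.
exact: (cvg_ball (cg i j x)).
Unshelve. all: by end_near. Qed.

(** * Finite-dimensional representation of cointegrated prices *)

Theorem proposition22 (R : realType)
  (disp : measure_display) (Omega : measurableType disp)
  (Pr : probability Omega R)
  (Fl : R -> set (set Omega)) (hFl : filtration Fl)
  (VF VP VC : hilbertType R)
  (sepF : separable VF) (sepP : separable VP) (sepC : separable VC)
  (opP : {linear VF -> VP}) (bndP : bounded_operator opP)
  (opC : {linear VP -> VC}) (bndC : bounded_operator opC)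
  (X : R -> Omega -> VF) (hX : predictable Fl X)
  (hcps : cointegration_pricing_system Pr opC opP X)
  (d n : nat)
  (hd : has_dim (ortho_compl (ker opC)) d)
  (hn : has_dim (ortho_compl (ker opP)) n) :
  forall (opT : {linear VC -> R^o}), continuous opT ->
    exists (cT : 'cV[R]_d) (Pbar : 'M[R]_(d, n)) (Xbar : R -> Omega -> 'cV[R]_n),
      [/\ predictable Fl Xbar,
          forall t w, 0 <= t ->
            opT (opC (opP (X t w))) = (cT^T *m Pbar *m Xbar t w) 0 0 &
          admits_limiting_distribution Pr
            (fun t w => (cT^T *m Pbar *m Xbar t w) 0 0)].
Proof.
move=> opT opT_cont.
have opP_cont := bounded_operator_continuous bndP.
have opC_cont := bounded_operator_continuous bndC.
have [f [_ fE]] := hd; have [e [_ eE]] := hn.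
pose TC : {linear VP -> R^o} := opT \o opC.
have [c cE] : exists c : 'I_d -> R,
    forall y, TC y = \sum_(j < d) c j * inner y (f j).
  apply: (functional_coordinates fE) => [y|y ky].
    by apply: continuous_comp; [exact: opC_cont|exact: opT_cont].
  by rewrite /TC/= ky linear0.
have coord j : exists b : 'I_n -> R,
    forall x, inner (opP x) (f j) = \sum_(i < n) b i * inner x (e i).
  have lin : linear (fun x => inner (opP x) (f j) : R^o).
    by move=> a x y; rewrite linearP inner_lincomb.
  pose phi : {linear VF -> R^o} :=
    HB.pack (fun x => inner (opP x) (f j) : R^o)
      (GRing.isLinear.Build R VF R^o *:%R _ lin).
  apply: (functional_coordinates (phi := phi) eE) => [x|x kx].
    exact: (continuous_comp (opP_cont x) (@inner_continuousl _ _ (f j) _)).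
  by rewrite /phi/= kx linear0l.
have [b bE] := choice coord.
pose Xbar t w : 'cV[R]_n := \col_i inner (X t w) (e i).
have TCPE t w : opT (opC (opP (X t w))) =
    ((\col_j c j)^T *m (\matrix_(j, i) b j i) *m Xbar t w) 0 0.
  rewrite -mulmxA mxE [LHS]cE; apply: eq_bigr => j _.
  rewrite !mxE bE; congr (_ * _).
  by apply: eq_bigr => i _; rewrite !mxE.
exists (\col_j c j), (\matrix_(j, i) b j i), Xbar; split => //.
- pose coords x : 'cV[R]_n := \col_i inner x (e i).
  apply: (predictable_comp (g := coords)) hX.
  apply: matrix_continuous => i j; under eq_fun do rewrite mxE.
  exact: inner_continuousl.
- have <- : (fun t w => opT (opC (opP (X t w)))) =
      fun t w => ((\col_j c j)^T *m (\matrix_(j, i) b j i) *m Xbar t w) 0 0.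
    by apply/funext => t; apply/funext => w; rewrite TCPE.
  exact: (admits_limiting_distribution_comp (g := opT : VC -> R)) hcps.
Qed.
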